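(* Let $E$ and $F$ be Banach lattices. Then $K^r_{AM-un}(E,F)$ is complete under the norm $\|\cdot\|_{AM-un}$.
   Context: For $x\in E_+$, $[-x,x]=\{y\in E:-x\le y\le x\}$. A net $(y_\alpha)$ in $F$ is un-convergent to $y\in F$ if $\||y_\alpha-y|\wedge u\|\to 0$ for every $u\in F_+$. A continuous linear operator $T:E\to F$ is AM-un-compact if for every $x\in E_+$ the bounded set $T[-x,x]$ is un-compact, meaning that every net in $T[-x,x]$ has a subnet that is un-convergent in $F$. $K_{AM-un}(E,F)$ is the set of AM-un-compact operators $E\to F$; operators are ordered by $S\le T$ iff $Sx\le Tx$ for all $x\in E_+$, and $K^+_{AM-un}(E,F)$ is the set of positive elements of $K_{AM-un}(E,F)$. Let $$K^r_{AM-un}(E,F)=\{T\in K_{AM-un}(E,F): \pm T\le S \text{ for some } S\in K^+_{AM-un}(E,F)\}.$$ For $T\in K^r_{AM-un}(E,F)$ the AM-un-norm is $$\|T\|_{AM-un}=\inf\{\|S\|: S\in K^+_{AM-un}(E,F),\ S\ge \pm T\},$$ where $\|S\|$ is the operator norm. *)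

(* Defs.v *)
From HB Require Import structures.
From mathcomp Require Import all_boot all_order all_algebra.
From mathcomp Require Import all_classical all_reals all_analysis.
Set Implicit Arguments.
Unset Strict Implicit.
Unset Printing Implicit Defensive.
Import Order.TTheory GRing.Theory Num.Theory.
Import numFieldNormedType.Exports.
Local Open Scope classical_set_scope.
Local Open Scope ring_scope.

(* A Banach lattice is a real Banach space with a lattice order compatible with
   the vector space structure and whose norm is a lattice norm: |x| <= |y| implies
   `|x| <= `|y|, where |x| is the join of x and - x.  The order is given by its
   own operations, and Order.Lattice is derived below, because HB rejects a
   common substructure of Order.Lattice and CompleteNormedModule declared after
   Num.RealDomain. *)
HB.mixin Record isBanachLattice (R : realType) E
    of CompleteNormedModule R E := {
  bl_le : rel E ;
  bl_meet : E -> E -> E ;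
  bl_join : E -> E -> E ;
  bl_le_refl : reflexive bl_le ;
  bl_le_anti : antisymmetric bl_le ;
  bl_le_trans : transitive bl_le ;
  bl_lexI : forall x y z, bl_le x (bl_meet y z) = bl_le x y && bl_le x z ;
  bl_leUx : forall x y z, bl_le (bl_join x y) z = bl_le x z && bl_le y z ;
  bl_leD2r : forall x y z : E, bl_le x y -> bl_le (x + z) (y + z) ;
  bl_leZ2l : forall (a : R) (x y : E), 0 <= a -> bl_le x y ->
    bl_le (a *: x) (a *: y) ;
  bl_ler_norm : forall x y : E,
    bl_le (bl_join x (- x)) (bl_join y (- y)) -> `|x| <= `|y|
}.

#[short(type="banachLatticeType")]
HB.structure Definition BanachLattice (R : realType) :=
  { E of CompleteNormedModule R E & isBanachLattice R E }.

Section BanachLatticeOrder.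
Context {R : realType} {E : banachLatticeType R}.

#[non_forgetful_inheritance]
HB.instance Definition _ := Order.Le_isPOrder.Build ring_display
  (BanachLattice.sort E) bl_le_refl bl_le_anti bl_le_trans.
#[non_forgetful_inheritance]
HB.instance Definition _ := Order.POrder_MeetJoin_isLattice.Build ring_display
  (BanachLattice.sort E) bl_lexI bl_leUx.

Definition modulus (x : E) : E := Order.join x (- x).

End BanachLatticeOrder.

Definition order_interval (R : realType) (E : banachLatticeType R) (a b : E) :
  set E := [set y | a <= y /\ y <= b].

Record directedSet := DirectedSet {
  dir_sort :> Type ;
  dir_le : dir_sort -> dir_sort -> Prop ;
  dir_inhabited : inhabited dir_sort ;
  dir_refl : forall i, dir_le i i ;
  dir_trans : forall i j k, dir_le i j -> dir_le j k -> dir_le i k ;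
  dir_ub : forall i j, exists2 k, dir_le i k & dir_le j k
}.

(* The section filter of a directed set: a net converges when its image of this
   filter does. *)
Definition tails (I : directedSet) : set_system I :=
  [set A | exists i, forall j, dir_le i j -> A j].

Arguments tails I : clear implicits.

(* y \o h is a subnet of y : I -> F; h is not required to be monotone. *)
Definition subnet_map (I J : directedSet) (h : J -> I) : Prop :=
  forall i, exists j0, forall j, dir_le j0 j -> dir_le i (h j).

Definition un_cvg (R : realType) (F : banachLatticeType R) (I : directedSet)
    (y : I -> F) (l : F) : Prop :=
  forall u : F, 0 <= u ->
    `|(Order.meet (modulus (y i - l)) u : F)| @[i --> tails I] --> (0 : R).

(* The un-limit is only required to lie in F, not in A. *)
Definition un_compact (R : realType) (F : banachLatticeType R) (A : set F) :
    Prop :=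
  forall (I : directedSet) (y : I -> F), (forall i, A (y i)) ->
    exists (J : directedSet) (h : J -> I),
      subnet_map h /\ exists l : F, un_cvg (y \o h) l.

Section AM_un_compact_operators.
Context {R : realType} {E F : banachLatticeType R}.
Implicit Types S T : {linear E -> F}.

Definition op_le (S T : E -> F) : Prop := forall x : E, 0 <= x -> S x <= T x.

Definition op_norm (T : E -> F) : R :=
  sup [set `|T x| | x in [set x : E | `|x| <= 1]].

Definition K_AM_un : set {linear E -> F} :=
  [set T | continuous T /\
    forall x : E, 0 <= x -> un_compact (T @` order_interval (- x) x)].

Definition K_AM_un_pos : set {linear E -> F} :=
  [set S | K_AM_un S /\ op_le (fun=> 0) S].

Definition dominates S T : Prop := op_le T S /\ op_le (\- T) S.

Definition K_AM_un_reg : set {linear E -> F} :=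
  [set T | K_AM_un T /\ exists2 S, K_AM_un_pos S & dominates S T].

Definition AM_un_norm T : R :=
  inf [set op_norm S | S in [set S | K_AM_un_pos S /\ dominates S T]].

End AM_un_compact_operators.

Arguments K_AM_un {R} E F.
Arguments K_AM_un_pos {R} E F.
Arguments K_AM_un_reg {R} E F.

(* Sequential completeness of a set K of operators for the distance N (S - T);
   \- is pointwise subtraction of linear maps. *)
Definition complete_under (R : realType) (E F : banachLatticeType R)
    (K : set {linear E -> F}) (N : {linear E -> F} -> R) : Prop :=
  forall T_ : nat -> {linear E -> F},
    (forall n, K (T_ n)) ->
    (forall e : R, 0 < e -> exists n0 : nat, forall m n : nat,
       (n0 <= m)%N -> (n0 <= n)%N -> N (T_ m \- T_ n) < e) ->
    exists2 T : {linear E -> F}, K T & N (T_ n \- T) @[n --> \oo] --> (0 : R).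

(* Main.v *)
From HB Require Import structures.
Require Import Defs.
From mathcomp Require Import all_boot all_order all_algebra.
From mathcomp Require Import all_classical all_reals all_analysis.
From mathcomp Require Import lra.

(** Regular domination controls the operator norm: if S >= T and S >= - T then
    |T x| <= S |x|, so `|T x| <= op_norm S * `|x|
    ([dominates_modulus], [dominates_bounded]).  A sequence that is Cauchy for
    the AM-un-norm is therefore Cauchy in operator norm and has a bounded
    pointwise limit T ([op_cauchy_cvg]).

    To estimate T_ n - T in the AM-un-norm, follow a subsequence that starts at
    T_ n and whose consecutive differences are dominated by positive AM-un-compact
    operators S_ j with norms below e / 2 ^ (j + 1).  The sum Q of the S_ j has
    norm at most e, is AM-un-compact, and dominates T_ n - T by telescoping
    ([K_AM_un_pos_series], [dominates_lim]).  This gives the convergence, and also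
    the regularity of T.

    The heart of the matter is that the AM-un-compact operators are closed in
    operator norm ([K_AM_un_closed]); it makes both Q and T AM-un-compact.  The
    un-topology of F is in general not complete, so total boundedness arguments
    do not produce un-limits in F.  Instead, pass to an ultrafilter, along which
    every approximating operator S_ n has a un-limit l_ n on a given family in
    an order interval ([un_compactP]).  Since closed balls are un-closed
    ([un_lim_norm_le]), l_ n - l_ m is no larger in norm than S_ n - S_ m allows;
    so the l_ n converge in the norm of F, and their limit is the un-limit sought
    for T. *)

Import Order.TTheory GRing.Theory Num.Theory.
Import numFieldNormedType.Exports.
Set Implicit Arguments.
Unset Strict Implicit.
Unset Printing Implicit Defensive.
Local Open Scope classical_set_scope.
Local Open Scope ring_scope.

(** * Vector lattice inequalities *)

Section VectorLattice.
Context {R : realType} {E : banachLatticeType R}.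
Implicit Types x y z u : E.

Lemma lat_lexI x y z : (x <= Order.meet y z) = (x <= y) && (x <= z).
Proof. exact: bl_lexI. Qed.

Lemma lat_leUx x y z : (Order.join x y <= z) = (x <= z) && (y <= z).
Proof. exact: bl_leUx. Qed.

Lemma lat_leD2r z x y : (x + z <= y + z) = (x <= y).
Proof.
apply/idP/idP => [h|]; last exact: bl_leD2r.
by rewrite -[x](addrK z) -[y](addrK z); exact: bl_leD2r.
Qed.

Lemma lat_leD x y z u : x <= y -> z <= u -> x + z <= y + u.
Proof.
move=> xy zu; apply: (@le_trans _ _ (y + z)); first by rewrite lat_leD2r.
by rewrite !(addrC y) lat_leD2r.
Qed.

Lemma lat_subr_ge0 x y : (0 <= y - x) = (x <= y).
Proof. by rewrite -[RHS](lat_leD2r (- x)) subrr. Qed.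

Lemma lat_leBlDr x y z : (x - y <= z) = (x <= z + y).
Proof. by rewrite -[LHS](lat_leD2r y) subrK. Qed.

Lemma lat_leN2 x y : (- x <= - y) = (y <= x).
Proof. by rewrite -[LHS](lat_leD2r (x + y)) addrA addNr add0r addrCA addNr addr0. Qed.

Lemma lat_addr_ge0 x y : 0 <= x -> 0 <= y -> 0 <= x + y.
Proof. by move=> x0 y0; rewrite -[0](addr0 0); exact: lat_leD. Qed.

Lemma lat_half x y : x + x <= y + y -> x <= y.
Proof.
have halve (z : E) : 2^-1 *: (z + z) = z.
  by rewrite scalerDr -scalerDl -[2^-1 in LHS]mul1r -splitr scale1r.
move=> h; rewrite -(halve x) -(halve y).
by apply: (@bl_leZ2l R E) => //; rewrite invr_ge0 ler0n.
Qed.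

Lemma ler_modulus x : x <= modulus x. Proof. exact: leUl. Qed.

Lemma lerN_modulus x : - x <= modulus x. Proof. exact: leUr. Qed.

Lemma modulus_le x y : x <= y -> - x <= y -> modulus x <= y.
Proof. by move=> xy nxy; rewrite /modulus lat_leUx xy. Qed.

Lemma modulus_ge0 x : 0 <= modulus x.
Proof.
apply: lat_half; rewrite addr0 -[leLHS](subrr x).
by apply: lat_leD; [exact: ler_modulus|exact: lerN_modulus].
Qed.

Lemma modulusN x : modulus (- x) = modulus x.
Proof. by rewrite /modulus opprK joinC. Qed.

Lemma modulus_id x : 0 <= x -> modulus x = x.
Proof.
move=> x0; apply/le_anti; rewrite ler_modulus andbT modulus_le//.
by apply: (le_trans _ (x0)); rewrite -[leRHS]oppr0 lat_leN2.
Qed.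

Lemma modulusD x y : modulus (x + y) <= modulus x + modulus y.
Proof.
apply: modulus_le; first by apply: lat_leD; exact: ler_modulus.
by rewrite opprD; apply: lat_leD; exact: lerN_modulus.
Qed.

Lemma le_norm_modulus x y : modulus x <= modulus y -> `|x| <= `|y|.
Proof. exact: bl_ler_norm. Qed.

Lemma norm_modulus x : `|modulus x| = `|x|.
Proof.
by apply/le_anti/andP; split; apply: le_norm_modulus;
  rewrite (modulus_id (modulus_ge0 x)).
Qed.

Lemma le_norm_lat x y : 0 <= x -> x <= y -> `|x| <= `|y|.
Proof.
by move=> x0 xy; apply: le_norm_modulus; rewrite !modulus_id// (le_trans x0).
Qed.

Lemma le_norm_interval x y : 0 <= x -> order_interval (- x) x y -> `|y| <= `|x|.
Proof.
move=> x0 [xy yx]; rewrite -(norm_modulus y).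
apply: le_norm_lat; first exact: modulus_ge0.
by apply: modulus_le => //; rewrite -lat_leN2 opprK.
Qed.

(** Truncation at a positive level is subadditive on the positive cone; this is
    what makes un-convergence compatible with addition. *)
Lemma meetD_le x y u : 0 <= x -> 0 <= y -> 0 <= u ->
  Order.meet (x + y) u <= Order.meet x u + Order.meet y u.
Proof.
move=> x0 y0 u0; rewrite -lat_leBlDr lat_lexI !lat_leBlDr.
have yu0 : 0 <= Order.meet y u by rewrite lat_lexI y0.
apply/andP; split; last first.
  by apply: (le_trans (leIr _ _)); rewrite -{1}(addr0 u) lat_leD.
rewrite [leRHS]addrC -lat_leBlDr lat_lexI !lat_leBlDr.
rewrite (addrC y) leIl/=; apply: (le_trans (leIr _ _)).
by rewrite -{1}(addr0 u) lat_leD.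
Qed.

Lemma closed_positive_cone (y_ : nat -> E) (y : E) :
  (forall n, 0 <= y_ n) -> y_ n @[n --> \oo] --> y -> 0 <= y.
Proof.
move=> y_ge0 yy; pose m := Order.join (- y) 0.
(* The negative part of y is dominated by |y_ n - y|, hence has norm zero. *)
have m0 : 0 <= m by exact: leUr.
have mle n : `|m| <= `|y - y_ n|.
  rewrite -(norm_modulus (y - _)); apply: le_norm_lat => //.
  rewrite lat_leUx modulus_ge0 andbT; apply: le_trans (lerN_modulus _).
  by rewrite opprB -{1}(add0r (- y)) lat_leD2r.
suff /eqP : `|m| = 0.
  rewrite normr_eq0 => /eqP me; rewrite -(opprK y) -oppr0 lat_leN2.
  by rewrite -me; exact: leUl.
apply/le_anti; rewrite normr_ge0 andbT; apply/ler_addgt0Pl => e e0.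
rewrite addr0; move/cvgrPdist_le : yy => /(_ e e0) [N _ /(_ N (leqnn N))].
exact: le_trans.
Qed.

End VectorLattice.

(** * Norm bounds and pointwise limits of operators *)

Lemma lat_cvg_ge (R : realType) (E : banachLatticeType R) (y_ : nat -> E)
    (a y : E) :
  (forall n, a <= y_ n) -> y_ n @[n --> \oo] --> y -> a <= y.
Proof.
move=> ay yy; rewrite -lat_subr_ge0.
apply: (@closed_positive_cone _ _ (fun n => y_ n - a)).
  by move=> n; rewrite lat_subr_ge0.
by apply: cvgB => //; exact: cvg_cst.
Qed.

Section OperatorBounds.
Context {R : realType} {E F : banachLatticeType R}.
Implicit Types (S T : {linear E -> F}) (c e : R).

Definition bounded_by (T : E -> F) c := forall x, `|T x| <= c * `|x|.

Lemma continuous_boundedP T : continuous T <-> exists c, bounded_by T c.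
Proof.
split=> [/linear_bounded_continuous/linear_boundedP/pinfty_ex_gt0[c _ Tc]|[c Tc]].
  by exists c.
apply/linear_bounded_continuous/linear_boundedP.
exists c; split; first exact: num_real.
by move=> r /ltW cr x; apply: (le_trans (Tc x)); apply: ler_wpM2r.
Qed.

Lemma op_norm_ge0 (T : E -> F) : 0 <= op_norm T.
Proof.
rewrite /op_norm; set A := [set _ | _ in _].
have [supA|/sup_out->//] := pselect (has_sup A).
apply: le_trans (ub_le_sup supA.2 (x := `|T 0|) _); first exact: normr_ge0.
by exists 0 => //=; rewrite normr0.
Qed.

Lemma op_norm_le (T : E -> F) c : 0 <= c -> bounded_by T c -> op_norm T <= c.
Proof.
move=> c0 Tc; apply: ge_sup.
  by exists `|T 0|, 0 => //=; rewrite normr0.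
move=> _ [x /= x1 <-]; apply: (le_trans (Tc x)).
by rewrite -[leRHS]mulr1 ler_wpM2l.
Qed.

Lemma op_norm_bounded T : continuous T -> bounded_by T (op_norm T).
Proof.
move=> /continuous_boundedP[c Tc] x.
have [->|x0] := eqVneq x 0; first by rewrite linear0 !normr0 mulr0.
have nx0 : 0 < `|x| by rewrite normr_gt0.
rewrite -ler_pdivrMr// mulrC.
have -> : `|x|^-1 * `|T x| = `|T (`|x|^-1 *: x)|.
  by rewrite linearZ normrZ ger0_norm// invr_ge0.
have c0 : 0 <= c.
  by rewrite -(pmulr_lge0 _ nx0); apply: le_trans (Tc x); exact: normr_ge0.
apply: ub_le_sup.
  exists c => _ [y /= y1 <-]; apply: (le_trans (Tc y)).
  by rewrite -[leRHS]mulr1 ler_wpM2l.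
by exists (`|x|^-1 *: x) => //=; rewrite normrZ ger0_norm ?invr_ge0// mulVf ?gt_eqF.
Qed.

(** Apply the two inequalities to the positive vectors |x| + x and |x| - x and
    add: this bounds T without decomposing x into positive and negative parts. *)
Lemma dominates_modulus S T x : dominates S T ->
  modulus (T x) <= S (modulus x).
Proof.
move=> [TS nTS].
have p0 : 0 <= modulus x + x.
  by rewrite -[x in _ + x]opprK lat_subr_ge0 lerN_modulus.
have n0 : 0 <= modulus x - x by rewrite lat_subr_ge0 ler_modulus.
have cross (a b : F) : (a + b) + (a - b) = a + a.
  by rewrite addrACA subrr addr0.
apply: modulus_le; apply: lat_half.
  have := lat_leD (TS _ p0) (nTS _ n0).
  by rewrite /= !linearD !linearN /= cross addrACA subrr add0r opprK.
have := lat_leD (nTS _ p0) (TS _ n0).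
by rewrite /= !linearD !linearN /= cross addrACA addNr add0r.
Qed.

Lemma dominates_bounded S T : continuous S -> dominates S T ->
  bounded_by T (op_norm S).
Proof.
move=> cS ST x; rewrite -(norm_modulus (T x)) -(norm_modulus x).
apply: le_trans (op_norm_bounded cS _).
by apply: le_norm_lat; [exact: modulus_ge0|exact: dominates_modulus].
Qed.

Lemma AM_un_norm_ge0 T : 0 <= AM_un_norm T.
Proof.
rewrite /AM_un_norm; set A := [set _ | _ in _].
have [->|/set0P A0] := eqVneq A set0; first by rewrite inf0.
by apply: lb_le_inf => // _ [S _ <-]; exact: op_norm_ge0.
Qed.

Lemma AM_un_norm_le S T : K_AM_un_pos E F S -> dominates S T ->
  AM_un_norm T <= op_norm S.
Proof.
move=> KS ST; apply: ge_inf; last by exists S.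
by exists 0 => _ [S' _ <-]; exact: op_norm_ge0.
Qed.

Lemma AM_un_norm_lt T c : (exists2 S, K_AM_un_pos E F S & dominates S T) ->
  AM_un_norm T < c ->
  exists S, [/\ K_AM_un_pos E F S, dominates S T & op_norm S < c].
Proof.
move=> [S0 KS0 S0T] /inf_lt[|_ [S [KS ST] <-] Sc]; last by exists S.
by exists (op_norm S0), S0.
Qed.

Lemma op_lim_bounded (T_ : nat -> {linear E -> F}) T S c N :
  (forall x, T_ n x @[n --> \oo] --> T x) ->
  (forall n, (N <= n)%N -> bounded_by (T_ n \- S) c) ->
  bounded_by (T \- S) c.
Proof.
move=> TT Tc x; apply: (cvgr_to_le (f := fun n => `|T_ n x - S x|) (F := \oo)).
  by apply: cvg_norm; apply: cvgB; [exact: TT|exact: cvg_cst].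
by exists N => // n /= /Tc/(_ x).
Qed.

Lemma op_cauchy_cvg (T_ : nat -> {linear E -> F}) :
  (forall e, 0 < e -> exists N, forall m n, (N <= m)%N -> (N <= n)%N ->
    bounded_by (T_ m \- T_ n) e) ->
  exists T : {linear E -> F}, forall x, T_ n x @[n --> \oo] --> T x.
Proof.
move=> T_cauchy.
have T_cvg x : cvg (T_ n x @[n --> \oo]).
  apply/cauchy_cvgP/cauchyP => e e0.
  pose d := e / 2 / (1 + `|x|).
  have x1 : 0 < 1 + `|x| by rewrite ltr_wpDr.
  have d0 : 0 < d by rewrite !divr_gt0.
  have [N TN] := T_cauchy d d0.
  exists (T_ N x), N => // n /= Nn; rewrite -ball_normE /=.
  apply: le_lt_trans (TN N n (leqnn _) Nn x) _.
  apply: (@le_lt_trans _ _ (d * (1 + `|x|))); first by rewrite ler_wpM2l ?lerDr// ltW.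
  by rewrite /d divfK ?gt_eqF// ltr_pdivrMr// ltr_pMr// ltr1n.
pose T x : F := lim (T_ n x @[n --> \oo]).
have Tlin : linear T.
  move=> a x y; apply/cvg_lim => //.
  under eq_fun do rewrite linearP.
  by apply: cvgD; [apply: cvgZl_tmp; exact: T_cvg|exact: T_cvg].
pose tm := GRing.isLinear.Build _ _ _ _ T Tlin.
pose T' : {linear E -> F} := HB.pack T tm.
by exists T' => x; exact: T_cvg.
Qed.

End OperatorBounds.

(** * Un-limits along filters *)

Section UnLimits.
Context {R : realType} {F : banachLatticeType R}.
Implicit Types (x y z u l : F).

(** Filters instead of nets: with G the tails of a directed set this is
    un-convergence of a net, while with G an ultrafilter there is no need to pass
    to subnets. *)
Definition un_lim (I : Type) (G : set_system I) (y : I -> F) (l : F) : Prop :=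
  forall u : F, 0 <= u ->
    `|(Order.meet (modulus (y i - l)) u : F)| @[i --> G] --> (0 : R).

Lemma norm_meet_le x y z u : 0 <= u -> modulus x <= modulus y + modulus z ->
  `|Order.meet (modulus x) u| <=
  `|Order.meet (modulus y) u| + `|Order.meet (modulus z) u|.
Proof.
move=> u0 xyz; apply: le_trans (ler_normD _ _); apply: le_norm_lat.
  by rewrite lat_lexI modulus_ge0.
apply: le_trans (meetD_le (modulus_ge0 y) (modulus_ge0 z) u0).
by rewrite lat_lexI leIr andbT (le_trans (leIl _ _)).
Qed.

Lemma norm_meet_le_norm x u : 0 <= u -> `|Order.meet (modulus x) u| <= `|x|.
Proof.
move=> u0; rewrite -(norm_modulus x); apply: le_norm_lat; last exact: leIl.
by rewrite lat_lexI modulus_ge0.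
Qed.

Lemma un_limP (I : Type) (G : set_system I) (FG : Filter G) (y : I -> F) l :
  un_lim G y l <-> forall u e, 0 <= u -> 0 < e ->
    \forall i \near G, `|Order.meet (modulus (y i - l)) u| <= e.
Proof.
split=> [yl u e u0 e0|yl u u0].
  have /cvgrPdist_le/(_ e e0) := yl u u0.
  by apply: filterS => i; rewrite sub0r normrN normr_id.
apply/cvgrPdist_le => e e0; apply: filterS (yl u e u0 e0) => i.
by rewrite sub0r normrN normr_id.
Qed.

Lemma un_lim_le (I : Type) (G : set_system I) (FG : Filter G)
    (y y1 y2 : I -> F) l l1 l2 :
  un_lim G y1 l1 -> un_lim G y2 l2 ->
  (forall i, modulus (y i - l) <= modulus (y1 i - l1) + modulus (y2 i - l2)) ->
  un_lim G y l.
Proof.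
move=> /un_limP h1 /un_limP h2 hy; apply/un_limP => u e u0 e0.
have e20 : 0 < e / 2 by rewrite divr_gt0.
apply: filterS2 (h1 u _ u0 e20) (h2 u _ u0 e20) => i i1 i2.
by rewrite (le_trans (norm_meet_le u0 (hy i)))// [leRHS]splitr lerD.
Qed.

Lemma un_limD (I : Type) (G : set_system I) (FG : Filter G)
    (y1 y2 : I -> F) l1 l2 :
  un_lim G y1 l1 -> un_lim G y2 l2 ->
  un_lim G (fun i => y1 i + y2 i) (l1 + l2).
Proof.
move=> h1 h2; apply: (un_lim_le FG h1 h2) => i.
by rewrite opprD addrACA modulusD.
Qed.

Lemma un_limB (I : Type) (G : set_system I) (FG : Filter G)
    (y1 y2 : I -> F) l1 l2 :
  un_lim G y1 l1 -> un_lim G y2 l2 ->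
  un_lim G (fun i => y1 i - y2 i) (l1 - l2).
Proof.
move=> h1 h2; apply: (un_lim_le FG h1 h2) => i.
by rewrite opprD addrACA -opprD -(modulusN (y2 i - l2)) modulusD.
Qed.

(** Truncating at the level u = |l| itself gives
    |l| <= |y i| + |y i - l| /\ |l|, and the last term tends to zero: closed
    balls are un-closed. *)
Lemma un_lim_norm_le (I : Type) (G : set_system I) (FG : ProperFilter G)
    (y : I -> F) l (c : R) :
  un_lim G y l -> (forall i, `|y i| <= c) -> `|l| <= c.
Proof.
move=> /un_limP yl yc; apply/ler_addgt0Pr => e e0.
have [i ie] := filter_ex (yl (modulus l) e (modulus_ge0 l) e0).
rewrite -(norm_modulus l); apply: (@le_trans _ _ (`|modulus (y i) +
    Order.meet (modulus (y i - l)) (modulus l)|)); last first.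
  by rewrite (le_trans (ler_normD _ _))// norm_modulus lerD.
apply: le_norm_lat; first exact: modulus_ge0.
rewrite addrC -lat_leBlDr lat_lexI !lat_leBlDr; apply/andP; split.
  rewrite -(modulusN (y i - l)) -[leLHS](_ : modulus (- (y i - l) + y i) = _).
    exact: modulusD.
  by rewrite opprB subrK.
by rewrite -[leLHS]addr0 lat_leD// modulus_ge0.
Qed.

End UnLimits.

(** * Nets and ultrafilters *)

Section NetsOfFilters.
Context {I : Type}.

#[global] Instance tails_filter (D : directedSet) : ProperFilter (tails D).
Proof.
apply: Build_ProperFilter_ex.
  by move=> A [i Ai]; exists i; apply: Ai; exact: dir_refl.
split.
- by have [i] := dir_inhabited D; exists i.
- move=> A B [i Ai] [j Bj]; have [k ik jk] := dir_ub i j.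
  by exists k => m km; split; [apply: Ai|apply: Bj];
    apply: dir_trans km.
- by move=> A B AB [i Ai]; exists i => j /Ai/AB.
Qed.

(** The points of a filter have to carry the sets they are taken from: ordering
    these sets by reverse inclusion makes the net of points end up in every set of
    the filter, and in no others ([filter_netE]). *)
Definition filter_index (G : set_system I) :=
  {p : set I * I | G p.1 /\ p.1 p.2}.

Definition filter_pair (G : set_system I) (A : set I) (i : I)
    (GA : G A) (Ai : A i) : filter_index G :=
  exist (fun p : set I * I => G p.1 /\ p.1 p.2) (A, i) (conj GA Ai).

Definition filter_index_le (G : set_system I) (p q : filter_index G) : Prop :=
  (sval q).1 `<=` (sval p).1.

Definition filter_point (G : set_system I) (p : filter_index G) : I := (sval p).2.

Lemma filter_index_inhabited (G : set_system I) :
  ProperFilter G -> inhabited (filter_index G).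
Proof.
move=> PG; have [i Ti] := filter_ex (filterT : G setT).
by constructor; exists (setT, i); split => //; exact: filterT.
Qed.

Lemma filter_index_ub (G : set_system I) : ProperFilter G ->
  forall p q : filter_index G,
    exists2 r, filter_index_le p r & filter_index_le q r.
Proof.
move=> PG [[A i] [/= GA Ai]] [[B j] [/= GB Bj]].
have GAB : G (A `&` B) by exact: filterI.
have [k ABk] := filter_ex GAB.
by exists (filter_pair GAB ABk); rewrite /filter_index_le /= => m [].
Qed.

Definition filter_net (G : set_system I) (PG : ProperFilter G) : directedSet :=
  @DirectedSet (filter_index G) (@filter_index_le G)
    (filter_index_inhabited PG) (fun p => @subset_refl _ _)
    (fun p q r pq qr => subset_trans qr pq) (filter_index_ub PG).

Lemma filter_netE (G : set_system I) (PG : ProperFilter G) :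
  @filter_point G @ tails (filter_net PG) = G.
Proof.
apply/seteqP; split=> [A [[[B i] [/= GB Bi]] BA]|A GA].
  apply: (filterS _ (GB)) => j Bj.
  by apply: (BA (filter_pair GB Bj)) => ?.
have [i Ai] := filter_ex GA.
by exists (filter_pair GA Ai) => -[[B j] [/= GB Bj]] BA; exact: BA.
Qed.

End NetsOfFilters.

Lemma subnet_mapP (D J : directedSet) (h : J -> D) :
  subnet_map h <-> tails D `<=` h @ tails J.
Proof.
split=> [hs A [i Ai]|hs i]; first by have [j hj] := hs i; exists j => k /hj/Ai.
by apply: (hs [set k | dir_le i k]); exists i.
Qed.

(** A universal subnet lives on an ultrafilter containing the tails.  Conversely
    a subnet of the net of an ultrafilter U pushes forward to a proper filter
    containing U, hence to U itself. *)
Lemma un_compactP (R : realType) (F : banachLatticeType R) (A : set F) :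
  un_compact A <-> forall (I : Type) (U : set_system I), UltraFilter U ->
    forall y : I -> F, (forall i, A (y i)) -> exists l, un_lim U y l.
Proof.
split=> [cA I U UU y Ay|cA D y Ay].
  have PU : ProperFilter U by exact: ultra_proper.
  pose D := filter_net PU.
  have [J [h [/subnet_mapP hs [l yl]]]] :=
    cA D (y \o @filter_point I U) (fun=> Ay _).
  exists l.
  have <- // : @filter_point I U @ (h @ tails J) = U.
  apply: max_filter => B UB; apply: hs.
  by rewrite -(filter_netE PU) in UB.
have [U [UU DU]] := ultraFilterLemma (tails_filter D).
have [l yl] := cA D U UU y Ay.
have PU : ProperFilter U by exact: ultra_proper.
pose J := filter_net PU.
exists J, (@filter_point D U); split.
  by apply/subnet_mapP; rewrite filter_netE.
by exists l; rewrite -(filter_netE PU) in yl.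
Qed.

(** * Closure properties of the AM-un-compact operators *)

Section Closure.
Context {R : realType} {E F : banachLatticeType R}.
Implicit Types (S T : {linear E -> F}).

Lemma K_AM_unP T : K_AM_un E F T <-> continuous T /\
  forall x : E, 0 <= x -> forall (I : Type) (U : set_system I), UltraFilter U ->
  forall z : I -> E, (forall i, order_interval (- x) x (z i)) ->
  exists l, un_lim U (fun i => T (z i)) l.
Proof.
split=> -[cT KT]; split=> // x x0; last first.
  apply/un_compactP => I U UU y Ty.
  have z_ex i : exists w, order_interval (- x) x w /\ T w = y i.
    by have [w xw Tw] := Ty i; exists w.
  have [z zy] := choice z_ex.
  have [l zl] := KT x x0 I U UU z (fun i => (zy i).1).
  exists l.
  by have -> : y = (fun i => T (z i)) by apply/funext => i; rewrite (zy i).2.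
move=> I U UU z xz; have /un_compactP := KT x x0; apply => // i.
by exists (z i).
Qed.

Lemma K_AM_un0 : K_AM_un E F \0.
Proof.
apply/K_AM_unP; split; first by move=> x; exact: cvg_cst.
move=> x x0 I U UU z xz; exists 0; apply/un_limP => u e u0 e0.
apply: nearW => i; rewrite (le_trans (norm_meet_le_norm _ u0))//.
by rewrite /= subrr normr0 ltW.
Qed.

Lemma K_AM_unD S T : K_AM_un E F S -> K_AM_un E F T -> K_AM_un E F (S \+ T).
Proof.
move=> /K_AM_unP[cS KS] /K_AM_unP[cT KT]; apply/K_AM_unP; split.
  by move=> x; apply: cvgD; [exact: cS|exact: cT].
move=> x x0 I U UU z xz.
have [l Sl] := KS x x0 I U UU z xz; have [m Tm] := KT x x0 I U UU z xz.
by exists (l + m); exact: un_limD.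
Qed.

(** The un-limits l_ n of approximating operators form a norm Cauchy sequence
    because closed balls are un-closed.  Norm completeness of F then provides the
    un-limit for T, although F need not be complete for its un-topology. *)
Lemma K_AM_un_closed T :
  (forall e : R, 0 < e -> exists2 S, K_AM_un E F S & bounded_by (T \- S) e) ->
  K_AM_un E F T.
Proof.
move=> T_lim; apply/K_AM_unP; split.
  have [S [cS _] TS] := T_lim 1 ltr01.
  have /continuous_boundedP[c Sc] := cS.
  apply/continuous_boundedP; exists (1 + c) => x.
  rewrite -[T x](subrK (S x)) mulrDl (le_trans (ler_normD _ _))// lerD//.
  exact: TS.
move=> x x0 I U UU z xz.
have zx i : `|z i| <= `|x| := le_norm_interval x0 (xz i).
have S_ex n : exists S, K_AM_un E F S /\ bounded_by (T \- S) (harmonic n).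
  have [|S KS TS] := T_lim (harmonic n); first exact: harmonic_gt0.
  by exists S.
have [S_ S_P] := choice S_ex.
have l_ex n : exists l, un_lim U (fun i => S_ n (z i)) l.
  by have [/K_AM_unP[_ KS] _] := S_P n; exact: (KS x).
have [l_ l_P] := choice l_ex.
pose a n : R := harmonic n * `|x|.
have a_cvg0 : a n @[n --> \oo] --> (0 : R).
  by rewrite -(mul0r `|x|); apply: cvgM; [exact: cvg_harmonic|exact: cvg_cst].
have TSa n i : `|T (z i) - S_ n (z i)| <= a n.
  have [_ TS] := S_P n; apply: (le_trans (TS (z i))).
  by rewrite ler_wpM2l// ltW// harmonic_gt0.
have l_dist m n : `|l_ m - l_ n| <= a m + a n.
  apply: (un_lim_norm_le _ (un_limB _ (l_P m) (l_P n))) => i.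
  rewrite -(subrKA (T (z i))) (le_trans (ler_normD _ _))// lerD//.
  by rewrite distrC.
have a_small e : 0 < e -> \forall n \near \oo, a n <= e.
  move=> e0; have /cvgrPdist_le/(_ e e0) := a_cvg0.
  by apply: filterS => n; rewrite sub0r normrN; apply: le_trans; exact: ler_norm.
have [l l_cvg] : exists l : F, l_ n @[n --> \oo] --> l.
  suff : cvg (l_ n @[n --> \oo]) by move=> ?; exists (lim (l_ n @[n --> \oo])).
  apply/cauchy_cvgP/cauchyP => e e0.
  have e30 : 0 < e / 3 by rewrite divr_gt0.
  have [N _ aN] := a_small _ e30.
  exists (l_ N), N => // n /= Nn; rewrite -ball_normE /=.
  apply: le_lt_trans (l_dist N n) _.
  have := lerD (aN N (leqnn N)) (aN n Nn) => /le_lt_trans; apply.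
  lra.
exists l; apply/un_limP => u e u0 e0.
have e30 : 0 < e / 3 by rewrite divr_gt0.
have [n [an ln]] : exists n, a n <= e / 3 /\ `|l - l_ n| <= e / 3.
  move/cvgrPdist_le : l_cvg => /(_ _ e30) l_near.
  by have [n] := filter_ex (filterI (a_small _ e30) l_near); exists n.
have /un_limP/(_ u _ u0 e30) := l_P n; apply: filterS => i ie /=.
have TSl : modulus (T (z i) - l) <= modulus (S_ n (z i) - l_ n) +
    modulus ((T (z i) - S_ n (z i)) - (l - l_ n)).
  rewrite -[T (z i) - l](_ : S_ n (z i) - l_ n +
      (T (z i) - S_ n (z i) - (l - l_ n)) = _); first exact: modulusD.
  by rewrite opprB addrACA addKr (addrC (S_ n _)) subrK.
have := norm_meet_le u0 TSl.
have := norm_meet_le_norm ((T (z i) - S_ n (z i)) - (l - l_ n)) u0.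
have := ler_normB (T (z i) - S_ n (z i)) (l - l_ n).
have := TSa n i.
lra.
Qed.

End Closure.

(** * Series of positive operators and completeness *)

Lemma lat_cvg_le (R : realType) (E : banachLatticeType R) (y_ : nat -> E)
    (a y : E) :
  (forall n, y_ n <= a) -> y_ n @[n --> \oo] --> y -> y <= a.
Proof.
move=> ya yy; rewrite -lat_leN2; apply: (@lat_cvg_ge _ _ (fun n => - y_ n)).
  by move=> n; rewrite lat_leN2.
exact: cvgN.
Qed.

Section Completeness.
Context {R : realType} {E F : banachLatticeType R}.
Implicit Types (S T Q : {linear E -> F}) (e : R).

Lemma K_AM_un_posD S T :
  K_AM_un_pos E F S -> K_AM_un_pos E F T -> K_AM_un_pos E F (S \+ T).
Proof.
move=> [KS S0] [KT T0]; split; first exact: K_AM_unD.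
by move=> x x0; apply: lat_addr_ge0; [exact: S0|exact: T0].
Qed.

Lemma dominatesB S1 S2 T1 T2 : dominates S1 T1 -> dominates S2 T2 ->
  dominates (S1 \+ S2) (T1 \- T2).
Proof.
move=> [h1 k1] [h2 k2]; split=> x x0 /=.
  by apply: lat_leD; [exact: h1|exact: k2].
by rewrite opprB addrC; apply: lat_leD; [exact: k1|exact: h2].
Qed.

Fixpoint psum (S_ : nat -> {linear E -> F}) (n : nat) : {linear E -> F} :=
  if n is m.+1 then psum S_ m \+ S_ m else \0.

(** With ratio 1/2 a term equals the sum of all later ones, so the tails of the
    series below are bounded by telescoping. *)
Lemma geometric_half e n :
  geometric e 2^-1 n = geometric e 2^-1 n.+1 + geometric e 2^-1 n.+1.
Proof. by rewrite /= exprSr mulrA; lra. Qed.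

Lemma geometric_half_gt0 e n : 0 < e -> 0 < geometric e 2^-1 n.
Proof. by move=> e0; rewrite /= mulr_gt0// exprn_gt0// invr_gt0. Qed.

Lemma geometric_half_small e e' : 0 < e' ->
  exists N, geometric e 2^-1 N < e'.
Proof.
move=> e'0; have : geometric e 2^-1 n @[n --> \oo] --> (0 : R).
  by apply: cvg_geometric; rewrite ger0_norm ?invr_ge0// invf_lt1// ltr1n.
move=> /cvgrPdist_lt/(_ e' e'0)[N _ /(_ N (leqnn N))] /= h.
by exists N; apply: le_lt_trans h; rewrite sub0r normrN ler_norm.
Qed.

Lemma psum_tail_bounded (S_ : nat -> {linear E -> F}) e m n : (m <= n)%N ->
  (forall j, bounded_by (S_ j) (geometric e 2^-1 j.+1)) ->
  bounded_by (psum S_ n \- psum S_ m)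
    (geometric e 2^-1 m - geometric e 2^-1 n).
Proof.
move=> mn Sb; rewrite -(subnK mn); elim: (n - m)%N => [|k IH] x.
  by rewrite add0n /= !subrr normr0 mul0r.
rewrite addSn [psum S_ _.+1]/= [X in X <= _]/= addrAC.
have -> : geometric e 2^-1 m - geometric e 2^-1 (k + m).+1 =
    (geometric e 2^-1 m - geometric e 2^-1 (k + m)) +
    geometric e 2^-1 (k + m).+1.
  by rewrite [geometric _ _ (k + m)]geometric_half; lra.
rewrite mulrDl (le_trans (ler_normD _ _))// lerD//; [exact: IH|exact: Sb].
Qed.

(** The sum of the series is a norm limit of partial sums, hence AM-un-compact
    by closedness. *)
Lemma K_AM_un_pos_series (S_ : nat -> {linear E -> F}) e : 0 < e ->
  (forall j, K_AM_un_pos E F (S_ j)) ->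
  (forall j, op_norm (S_ j) <= geometric e 2^-1 j.+1) ->
  exists Q, [/\ K_AM_un_pos E F Q,
    forall n, op_le (psum S_ n) Q & op_norm Q <= e].
Proof.
move=> e0 KS Se.
have Sb j : bounded_by (S_ j) (geometric e 2^-1 j.+1).
  move=> x; have [[cS _] _] := KS j.
  by apply: le_trans (op_norm_bounded cS x) _; rewrite ler_wpM2r.
have tail m n : (m <= n)%N ->
    bounded_by (psum S_ n \- psum S_ m) (geometric e 2^-1 m).
  move=> mn x; apply: le_trans (psum_tail_bounded mn Sb x) _.
  by rewrite ler_wpM2r// gerBl ltW// geometric_half_gt0.
have [Q QP] : exists Q : {linear E -> F},
    forall x, psum S_ n x @[n --> \oo] --> Q x.
  apply: op_cauchy_cvg => d d0; have d20 : 0 < d / 2 by rewrite divr_gt0.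
  have [N eN] := geometric_half_small e d20.
  exists N => m n Nm Nn x.
  have := tail N m Nm x; have := tail N n Nn x.
  have := ler_normB (psum S_ m x - psum S_ N x) (psum S_ n x - psum S_ N x).
  rewrite opprB subrKA [X in `|X|]/= => h hn hm.
  rewrite /= in hn hm *.
  apply: (le_trans h); apply: (le_trans (lerD hm hn)).
  by rewrite -mulrDl ler_wpM2r// [leRHS]splitr lerD// ltW.
have KP n : K_AM_un_pos E F (psum S_ n).
  elim: n => [|n IH]; last exact: K_AM_un_posD.
  by split; [exact: K_AM_un0|move=> x x0 /=].
have Qtail N : bounded_by (Q \- psum S_ N) (geometric e 2^-1 N).
  by apply: (op_lim_bounded QP (N := N)) => n; exact: tail.
have PQ n : op_le (psum S_ n) Q.
  move=> x x0; apply: (lat_cvg_ge (y_ := fun k => psum S_ (k + n)%N x)).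
    elim=> [|k IH]; first by rewrite add0n.
    rewrite addSn /=; apply: (le_trans IH).
    by rewrite -[leLHS]addr0 lat_leD//; have [_] := KS (k + n)%N; exact.
  by rewrite (cvg_shiftn n (fun k => psum S_ k x)); exact: QP.
exists Q; split=> //.
- split; last by move=> x x0; have := PQ 0 x x0.
  apply: K_AM_un_closed => d d0; have [N eN] := geometric_half_small e d0.
  exists (psum S_ N); first by have [] := KP N.
  by move=> x; apply: le_trans (Qtail N x) _; rewrite ler_wpM2r// ltW.
- apply: op_norm_le; first exact: ltW.
  by move=> x; have := Qtail 0 x; rewrite /= subr0 expr0 mulr1.
Qed.

(** The differences t (j + 1) - t j add up to t n - t 0, which Q dominates for
    every n; closedness of the positive cone passes this to the limit. *)
Lemma dominates_lim (t S_ : nat -> {linear E -> F}) T Q :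
  (forall j, dominates (S_ j) (t j.+1 \- t j)) ->
  (forall n, op_le (psum S_ n) Q) ->
  (forall x, t n x @[n --> \oo] --> T x) ->
  dominates Q (t 0%N \- T).
Proof.
move=> St SQ tT.
have tele n : dominates (psum S_ n) (t n \- t 0%N).
  elim: n => [|n [IH1 IH2]]; first by split=> x x0 /=; rewrite subrr ?oppr0.
  have [h k] := St n; split=> x x0 /=.
    by rewrite -(subrKA (t n x)) addrC lat_leD//; [exact: IH1|exact: h].
  by rewrite -(subrKA (t n x)) opprD addrC lat_leD//; [exact: IH2|exact: k].
split=> x x0 /=.
  rewrite lat_leBlDr addrC -lat_leBlDr.
  apply: (lat_cvg_ge _ (tT x)) => n; rewrite lat_leBlDr addrC -lat_leBlDr.
  by have [_ /(_ x x0)/le_trans] := tele n; rewrite /= opprB; apply; exact: SQ.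
rewrite opprB lat_leBlDr.
apply: (lat_cvg_le _ (tT x)) => n; rewrite -lat_leBlDr.
by have [/(_ x x0)/le_trans + _] := tele n; apply; exact: SQ.
Qed.

End Completeness.

Section CauchySequence.
Context {R : realType} {E F : banachLatticeType R}.
Context (T_ : nat -> {linear E -> F})
  (T_reg : forall n, K_AM_un_reg E F (T_ n))
  (T_cauchy : forall e : R, 0 < e -> exists n0 : nat, forall m n : nat,
    (n0 <= m)%N -> (n0 <= n)%N -> AM_un_norm (T_ m \- T_ n) < e).

(** AM_un_norm is an infimum, with value 0 on the empty set; regularity of T_ m
    and T_ n makes the set of dominating operators nonempty, so that a small
    norm does provide a small dominating operator. *)
Lemma cauchy_dominated e : 0 < e -> exists N, forall m n,
  (N <= m)%N -> (N <= n)%N -> exists S, [/\ K_AM_un_pos E F S,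
    dominates S (T_ m \- T_ n) & op_norm S < e].
Proof.
move=> e0; have [N TN] := T_cauchy e0; exists N => m n Nm Nn.
apply: AM_un_norm_lt (TN m n Nm Nn).
have [_ [Sm Km Dm]] := T_reg m; have [_ [Sn Kn Dn]] := T_reg n.
by exists (Sm \+ Sn); [exact: K_AM_un_posD|exact: dominatesB].
Qed.

Lemma cauchy_lim : exists T : {linear E -> F},
  forall x, T_ n x @[n --> \oo] --> T x.
Proof.
apply: op_cauchy_cvg => e e0; have [N TN] := cauchy_dominated e0.
exists N => m n Nm Nn x.
have [S [[[cS _] _] SD /ltW Se]] := TN m n Nm Nn.
apply: le_trans (dominates_bounded cS SD x) _.
by rewrite ler_wpM2r.
Qed.

Lemma cauchy_lim_dominated (T : {linear E -> F}) e :
  (forall x, T_ n x @[n --> \oo] --> T x) -> 0 < e ->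
  exists N, forall n, (N <= n)%N -> exists Q, [/\ K_AM_un_pos E F Q,
    dominates Q (T_ n \- T) & op_norm Q <= e].
Proof.
move=> TT e0.
have [M MP] := choice (fun j => cauchy_dominated (geometric_half_gt0 j.+1 e0)).
exists (M 0%N) => n Mn.
(* The subsequence starts at n itself, so that its limit estimate bounds
   T_ n - T directly. *)
pose fix k j := if j is i.+1 then (k i + M i.+1).+1 else n.
have Mk j : (M j <= k j)%N.
  by case: j => [//|j] /=; rewrite (leq_trans (leq_addl (k j) _)).
have kS j : (k j <= k j.+1)%N by rewrite /= ltnW// ltnS leq_addr.
have k_ge j : (j <= k j)%N.
  by elim: j => [//|j IH] /=; rewrite ltnS (leq_trans IH)// leq_addr.
have S_ex j : exists S, [/\ K_AM_un_pos E F S,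
    dominates S (T_ (k j.+1) \- T_ (k j)) & op_norm S < geometric e 2^-1 j.+1].
  by apply: MP => //; exact: leq_trans (Mk j) (kS j).
have [S_ SP] := choice S_ex.
have [||Q [KQ SQ Qe]] := @K_AM_un_pos_series _ _ _ S_ e e0.
- by move=> j; have [] := SP j.
- by move=> j; have [_ _ /ltW] := SP j.
exists Q; split=> //.
apply: (@dominates_lim _ _ _ (T_ \o k) S_) => // [j|x].
  by have [] := SP j.
apply: (cvg_comp k (fun i => T_ i x)) (TT x).
by move=> A [N _ NA]; exists N => // j /= Nj; apply: NA; exact: leq_trans (k_ge j).
Qed.

End CauchySequence.

Theorem theorem3p8 (R : realType) (E F : banachLatticeType R) :
  complete_under (K_AM_un_reg E F) AM_un_norm.
Proof.
move=> T_ T_reg T_cauchy.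
have [T TT] := cauchy_lim T_reg T_cauchy.
have Tdom e (e0 : 0 < e) := cauchy_lim_dominated T_reg T_cauchy TT e0.
exists T; first split.
- apply: K_AM_un_closed => e /Tdom[N /(_ N (leqnn N))[Q [[[cQ _] _] QD Qe]]].
  exists (T_ N); first by have [] := T_reg N.
  move=> x; rewrite /= distrC.
  by apply: le_trans (dominates_bounded cQ QD x) _; rewrite ler_wpM2r.
- have [N /(_ N (leqnn N))[Q [KQ QD _]]] := Tdom 1 ltr01.
  have [_ [S KS SD]] := T_reg N; exists (S \+ Q); first exact: K_AM_un_posD.
  have [h k] := dominatesB SD QD.
  by split=> x x0; [move: (h x x0)|move: (k x x0)]; rewrite /= subKr.
apply/cvgrPdist_le => e e0; have [N TN] := Tdom e e0.
exists N => // n /= Nn; have [Q [KQ QD Qe]] := TN n Nn.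
rewrite sub0r normrN ger0_norm ?AM_un_norm_ge0//.
exact: le_trans (AM_un_norm_le KQ QD) Qe.
Qed.
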